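(* Let $s$ be a Brownian motion (centered, with variance parameter $\sigma^2>0$). Then for every integer $M\geq 0$, $$\mathrm{MSE}_M^{\rm greedy}=\mathrm{MSE}_M^{\rm lin},$$ where $\mathrm{MSE}_M^{\rm method}=\mathbb{E}\big[\|s-\mathrm{P}_M^{\rm method}(s)\|_{L_2([0,1])}^2\big]$ for $\mathrm{method}\in\{\mathrm{lin},\mathrm{greedy}\}$.
   Context: All processes are restricted to $[0,1]$, and $s(0)=0$. Haar basis of $L_2([0,1])$: $\phi=\mathbb{1}_{[0,1]}$, $\psi=\mathbb{1}_{[0,1/2]}-\mathbb{1}_{[1/2,1]}$, $\psi_{j,k}=2^{j/2}\psi(2^j\cdot-k)$ for $j\geq 0$, $0\leq k\leq 2^j-1$. The orthonormal basis is $\{\phi\}\cup\{\psi_{j,k}\}_{j\geq 0,\,0\leq k\leq 2^j-1}$, ordered by the index $\mathrm{Ind}(\phi)=0$, $\mathrm{Ind}(\psi_{j,k})=2^j+k$. Linear approximation: for $f\in L_2([0,1])$, $\mathrm{P}_M^{\rm lin}(f)$ is the partial Haar expansion of $f$ obtained by keeping the first $M$ terms, i.e. those of index $0,1,\ldots,M-1$ with respect to $\mathrm{Ind}$. Greedy approximation: $\mathrm{P}_M^{\rm greedy}(f)$ is the partial Haar expansion of $f$ obtained by keeping only the first $M$ nonzero coefficients among $\langle f,\phi\rangle,\langle f,\psi_{j,k}\rangle$ (first with respect to $\mathrm{Ind}$), and discarding all others; if $f$ has fewer than $M$ nonzero coefficients, all are kept. *)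

(* Defs.v *)
From HB Require Import structures.
From mathcomp Require Import all_boot all_order all_algebra.
From mathcomp Require Import all_classical all_reals all_analysis.

Set Implicit Arguments.
Unset Strict Implicit.
Unset Printing Implicit Defensive.

Import Order.TTheory GRing.Theory Num.Theory.
Import numFieldNormedType.Exports.

Local Open Scope classical_set_scope.
Local Open Scope ring_scope.

Section L2_unit_interval.
Context {R : realType}.
Implicit Types f g : R -> R.

Definition inner01 f g : R :=
  (\int[lebesgue_measure]_(x in `[0%R, 1%R]) (f x * g x))%R.

(* Valued in the extended reals, so that it is meaningful (+oo) outside L2. *)
Definition sqnorm01 f : \bar R :=
  (\int[lebesgue_measure]_(x in `[0%R, 1%R]) ((f x) ^+ 2)%:E)%E.

End L2_unit_interval.

Section haar_basis.
Context {R : realType}.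

Definition haar_phi : R -> R := \1_`[0, 1].

Definition haar_psi : R -> R := fun x => \1_`[0, 2^-1] x - \1_`[2^-1, 1] x.

Definition haar_psijk (j k : nat) : R -> R :=
  fun x => 2 `^ (j%:R / 2) * haar_psi (2 ^+ j * x - k%:R).

(* The basis element of index n: any n > 0 is 2^j + k for exactly one pair
   (j, k) with k < 2^j, namely j = trunc_log 2 n and k = n - 2^j. *)
Definition haar (n : nat) : R -> R :=
  if n is 0 then haar_phi
  else haar_psijk (trunc_log 2 n) (n - 2 ^ trunc_log 2 n)%N.

Lemma haar_ind_phi : haar 0 = haar_phi.
Proof. by []. Qed.

Lemma haar_ind_psi (j k : nat) : (k < 2 ^ j)%N ->
  haar (2 ^ j + k)%N = haar_psijk j k.
Proof.
move=> kj; have jE : trunc_log 2 (2 ^ j + k) = j.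
  by apply: trunc_log_eq => //; rewrite leq_addr expnS mul2n -addnn ltn_add2l.
have : (0 < 2 ^ j + k)%N by rewrite addn_gt0 expn_gt0.
by rewrite /haar jE addKn; case: (2 ^ j + k)%N.
Qed.

Definition haar_coef (f : R -> R) (n : nat) : R := inner01 f (haar n).

End haar_basis.

Section approximations.
Context {R : realType}.
Implicit Type f : R -> R.

Definition P_lin (M : nat) f : R -> R :=
  fun x => \sum_(n < M) haar_coef f n * haar n x.

(* Indices of the first M nonzero coefficients (of all of them, if there are
   fewer than M). *)
Definition greedy_kept (M : nat) f : set nat :=
  [set n | haar_coef f n != 0 /\
           (\sum_(i < n) (haar_coef f i != 0%R) < M)%N].

Lemma finite_greedy_kept M f : finite_set (greedy_kept M f).
Proof.
pose rk n := (\sum_(i < n) (haar_coef f i != 0%R))%N.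
have rkS n : rk n.+1 = (rk n + (haar_coef f n != 0%R))%N by rewrite /rk big_ord_recr.
have rk_homo : {homo rk : m n / (m <= n)%N}.
  by apply: homo_leq => // [p m n|n]; [exact: leq_trans|rewrite rkS leq_addr].
have rk_lt m n : haar_coef f m != 0 -> (m < n)%N -> (rk m < rk n)%N.
  by move=> m0 /rk_homo; apply: leq_trans; rewrite rkS m0 addn1.
have rk_inj : {in greedy_kept M f &, injective rk}.
  move=> m n /set_mem[m0 _] /set_mem[n0 _] mn.
  by case: (ltngtP m n) => // /rk_lt; rewrite mn ltnn => /(_ ltac:(by [])).
apply: (@card_le_finite _ _ _ `I_M); last exact: finite_II.
rewrite -(card_le_eql (inj_card_eq rk_inj)); apply: subset_card_le.
by move=> _ [n [_ nM] <-].
Qed.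

Definition P_greedy (M : nat) f : R -> R :=
  fun x => \sum_(n \in greedy_kept M f) haar_coef f n * haar n x.

End approximations.

Section processes.
Context {d : measure_display} {T : measurableType d} {R : realType}.
Variable P : probability T R.

Definition mutually_independent (I : finType) (X : I -> T -> R) : Prop :=
  forall (J : {set I}) (A : I -> set R),
    (forall i, i \in J -> measurable (A i)) ->
    P (\bigcap_(i in [set` J]) X i @^-1` A i) =
    \big[*%E/1%E]_(i in J) P (X i @^-1` A i).

(* Centered Brownian motion on [0, 1] with variance parameter sigma ^+ 2. The
   second argument of normal_prob is the standard deviation. Times outside
   [0, 1] are irrelevant. *)
Record brownian_motion01 (sigma : R) (s : R -> {RV P >-> R}) : Prop := {
  bm_start : {ae P, forall w, s 0 w = 0} ;
  bm_indep : forall (n : nat) (t : nat -> R),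
    0 <= t 0 -> (forall i, (i < n)%N -> t i < t i.+1) -> t n <= 1 ->
    mutually_independent (fun (i : 'I_n) w => s (t i.+1) w - s (t i) w) ;
  bm_gauss : forall u t : R, 0 <= u -> u < t -> t <= 1 ->
    forall A : set R, measurable A ->
    pushforward P (fun w => s t w - s u w) A =
    normal_prob 0 (Num.sqrt (sigma ^+ 2 * (t - u))) A ;
  bm_cont : {ae P, forall w, {within `[0, 1], continuous (fun t => s t w)}}
}.

(* Mean square error of an approximation method, applied pathwise. *)
Definition MSE (approx : (R -> R) -> (R -> R)) (s : R -> {RV P >-> R}) : \bar R :=
  (\int[P]_w sqnorm01 (fun t => s t w - approx (fun u => s u w) t)%R)%E.

End processes.

(* Main.v *)
Require Import Defs.
From mathcomp Require Import all_boot all_order all_algebra.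
From mathcomp Require Import all_classical all_reals all_analysis measurable_realfun.
From mathcomp Require Import ring lra.

(* Almost surely every Haar coefficient of a Brownian path is nonzero, so that
   the first M nonzero coefficients are the first M coefficients and the two
   approximations coincide pathwise almost surely.

   Along a continuous path started at 0, the coefficient on h is the limit of
   Riemann sums, which after summation by parts are sums of independent centered
   Gaussian increments weighted by discrete tail integrals of h. As h is a nonzero
   constant on some interval, two tails a fixed distance apart in that interval
   differ by a fixed amount, so the variances of these sums are bounded below.
   Integrating a centered Gaussian density of width e against such a sum gives
   a Gaussian density with the variances added, evaluated at 0; hence the sum lies
   in [-e, e] with probability O(e), uniformly in the mesh, and the limit
   vanishes with probability 0. *)

Set Implicit Arguments.
Unset Strict Implicit.
Unset Printing Implicit Defensive.

Import Order.TTheory GRing.Theory Num.Theory.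
Import numFieldNormedType.Exports.
Import HBNNSimple.
Local Open Scope classical_set_scope.
Local Open Scope ring_scope.

(** * Integrals of nonnegative functions equal almost everywhere *)

(* Unlike [ge0_ae_eq_integral], this needs no measurability, which is not known
   for the random error of the greedy approximation. *)
Lemma ge0_le_integral_ae d (T : measurableType d) (R : realType)
    (mu : {measure set T -> \bar R}) (f g : T -> \bar R) :
  (forall x, 0 <= f x)%E -> (forall x, 0 <= g x)%E ->
  {ae mu, forall x, f x = g x} -> (\int[mu]_x f x <= \int[mu]_x g x)%E.
Proof.
move=> f0 g0 [N [mN N0 fgN]].
rewrite !ge0_integralTE//; apply: ge_ereal_sup => _ [h hf <-].
have mNC : measurable (~` N) by exact: measurableC.
(* The simple function [h] below [f], set to 0 on the null set [N], lies below [g] everywhere and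
   keeps its integral. *)
apply: le_trans (ereal_sup_ubound _); last first.
  exists (proj_nnsfun h mNC) => //= x; rewrite /proj_nnsfun/= mindicE.
  case: (boolP (x \in ~` N)) => [/set_mem xN|_]; rewrite ?mulr1 ?mulr0//.
  rewrite (le_trans (hf x))// le_eqVlt; apply/orP; left; apply/eqP.
  by apply: contrapT => fgx; apply: xN; apply: fgN.
rewrite -[leLHS]/(sintegral mu h) -[in leLHS](patch_setT (fun=> 0) h).
rewrite -integral_nnsfun// -(patch_setT (fun=> 0) (proj_nnsfun _ _)).
rewrite -integral_nnsfun//.
rewrite le_eqVlt; apply/orP; left; apply/eqP.
apply: ge0_ae_eq_integral => //.
- by apply/measurable_EFinP.
- by apply/measurable_EFinP; exact: (@measurable_funPT _ _ _ _ (proj_nnsfun h mNC)).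
- by move=> x _; rewrite lee_fin.
- by move=> x _; rewrite lee_fin (@fun_ge0 _ _ (proj_nnsfun h mNC)).
exists N; split => // x /= hx; apply: contrapT => xN; apply: hx => _.
by rewrite /proj_nnsfun/= mindicE mem_set// mulr1.
Qed.

Lemma ge0_integral_ae_eq d (T : measurableType d) (R : realType)
    (mu : {measure set T -> \bar R}) (f g : T -> \bar R) :
  (forall x, 0 <= f x)%E -> (forall x, 0 <= g x)%E ->
  {ae mu, forall x, f x = g x} -> (\int[mu]_x f x = \int[mu]_x g x)%E.
Proof.
move=> f0 g0 fg; apply/eqP; rewrite eq_le !ge0_le_integral_ae//.
by apply: filterS fg => x ->.
Qed.

(** * Greedy selection without zero coefficients *)

(** The rank of [n] among the nonzero coefficients is then [n] itself, so the kept indices are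
    exactly those below [M]. *)
Lemma P_greedy_coef_neq0 (R : realType) (M : nat) (f : R -> R) :
  (forall n, haar_coef f n != 0) -> P_greedy M f = P_lin M f.
Proof.
move=> f0; apply/funext => x; rewrite /P_greedy /P_lin.
have -> : greedy_kept M f = `I_M; last by rewrite -fsbig_ord.
apply/seteqP; split => n; rewrite /greedy_kept/=.
  by move=> [_]; under eq_bigr do rewrite f0; rewrite sum1_card card_ord.
by move=> nM; split => //; under eq_bigr do rewrite f0; rewrite sum1_card card_ord.
Qed.

(** * Products and integrals of Gaussian densities *)

(** The Radon-Nikodym derivative of [normal_prob m s] and [normal_pdf m s] have the same integral
    over every measurable set, hence agree almost everywhere. *)
Lemma integral_normal_prob (R : realType) (m s : R) (f : R -> \bar R) :
  measurable_fun setT f -> (\int[normal_prob m s]_x `|f x| < +oo)%E ->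
  (\int[normal_prob m s]_x f x =
   \int[lebesgue_measure]_x (f x * (normal_pdf m s x)%:E))%E.
Proof.
move=> mf finf; have dom := @normal_prob_dominates R m s.
rewrite -(Radon_Nikodym_change_of_variables dom)//=; last first.
  by apply/integrableP; split.
apply: ae_eq_integral => //.
- exact: emeasurable_funM.
- apply: emeasurable_funM => //=; apply/measurable_EFinP.
  exact: measurable_normal_pdf.
- apply: ae_eqe_mul2l => /=.
  rewrite Radon_NikodymE//=.
  case: cid => /= h [h1 h2 h3].
  apply: integral_ae_eq => //=.
  + by apply/measurableT_comp => //; exact: measurable_normal_pdf.
  + by move=> E E01 mE; rewrite -h3.
Qed.

Lemma complete_square (F : fieldType) (s t a x y v : F) :
  v = s ^+ 2 + a ^+ 2 * t ^+ 2 -> s != 0 -> t != 0 -> v != 0 -> 2 != 0 :> F ->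
  - (x + a * y) ^+ 2 / (s ^+ 2 *+ 2) + - y ^+ 2 / (t ^+ 2 *+ 2) =
  - x ^+ 2 / (v *+ 2) +
  - (y - - (a * x * t ^+ 2) / v) ^+ 2 / (s ^+ 2 * t ^+ 2 / v *+ 2).
Proof. by move=> -> s0 t0 v0 n0; field; rewrite exprMn v0 n0 t0. Qed.

(** Completing the square in [y] splits the product into a factor free of [y], whose variance is the
    sum of the two, and a normal density in [y]. *)
Lemma normal_pdf_mul (R : realType) (s t a x y : R) : 0 < s -> 0 < t ->
  normal_pdf 0 s (x + a * y) * normal_pdf 0 t y =
  normal_pdf 0 (Num.sqrt (s ^+ 2 + a ^+ 2 * t ^+ 2)) x *
  normal_pdf (- (a * x * t ^+ 2) / (s ^+ 2 + a ^+ 2 * t ^+ 2))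
    (s * t / Num.sqrt (s ^+ 2 + a ^+ 2 * t ^+ 2)) y.
Proof.
move=> s0 t0; set v := s ^+ 2 + _.
have v0 : 0 < v by rewrite ltr_pwDl ?exprn_gt0// mulr_ge0 ?sqr_ge0.
have sv0 : 0 < Num.sqrt v by rewrite sqrtr_gt0.
have w0 : 0 < s * t / Num.sqrt v by rewrite divr_gt0 ?mulr_gt0.
rewrite !normal_pdfE ?gt_eqF// /normal_peak /normal_fun.
rewrite !exprMn exprVn !sqr_sqrtr ?(ltW v0)//.
rewrite [LHS]mulrACA [RHS]mulrACA -!expRD -!invfM -!sqrtrM; last 2 first.
- by rewrite pmulrn_lge0// mulr_ge0 ?pi_ge0// ltW.
- by rewrite pmulrn_lge0// mulr_ge0 ?pi_ge0// sqr_ge0.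
congr (_ * _).
  congr (_^-1); congr (Num.sqrt _); move: pi => p.
  clearbody v; field.
  by rewrite gt_eqF.
congr expR; rewrite !subr0; apply: complete_square => //.
- by rewrite gt_eqF.
- by rewrite gt_eqF.
- by rewrite gt_eqF.
Qed.

(** In the factorization of [normal_pdf_mul] the density in [y] has integral 1, and only the factor
    in [x] remains. *)
Lemma integral_normal_pdf_shift (R : realType) (s t a x : R) : 0 < s -> 0 < t ->
  (\int[normal_prob 0 t]_y (normal_pdf 0 s (x + a * y))%:E =
   (normal_pdf 0 (Num.sqrt (s ^+ 2 + a ^+ 2 * t ^+ 2)) x)%:E)%E.
Proof.
move=> s0 t0.
have mf : measurable_fun setT (fun y => (normal_pdf 0 s (x + a * y))%:E).
  apply/measurable_EFinP; apply: measurableT_comp.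
    exact: measurable_normal_pdf.
  by apply: measurable_funD => //; exact: measurable_funM.
(* Integrability: the density is bounded by its peak, and the measure is a probability. *)
rewrite integral_normal_prob//; last first.
  apply: (@le_lt_trans _ _ (\int[normal_prob 0 t]_y (normal_peak s)%:E)%E).
    apply: ge0_le_integral => //=.
    - apply/measurable_EFinP; apply: measurableT_comp => //.
      exact/measurable_EFinP.
    - move=> y _; rewrite lee_fin ger0_norm ?normal_pdf_ge0//.
      by rewrite normal_pdf_ub// gt_eqF.
  by rewrite integral_cst//= probability_setT mule1 ltry.
under eq_integral do rewrite -EFinM normal_pdf_mul// EFinM.
rewrite ge0_integralZl//=.
- by rewrite integral_normal_pdf mule1.
- by apply/measurable_EFinP; exact: measurable_normal_pdf.
- by move=> y _; rewrite lee_fin normal_pdf_ge0.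
- by rewrite lee_fin normal_pdf_ge0.
Qed.

(** * Independent pairs and integration against laws *)

Section independence.
Context d (T : measurableType d) (R : realType) (P : probability T R).

(** Both sides are finite measures in [C] that agree on measurable rectangles, a generating class
    stable under intersection. *)
Lemma indep_pair_event (X Y : T -> R) (E : set T) :
  measurable_fun setT X -> measurable_fun setT Y -> measurable E ->
  (forall A B, measurable A -> measurable B ->
    P (X @^-1` A `&` Y @^-1` B `&` E) = (P (X @^-1` A `&` Y @^-1` B) * P E)%E) ->
  forall C : set (R * R), measurable C ->
    P ((fun w => (X w, Y w)) @^-1` C `&` E) =
    (P ((fun w => (X w, Y w)) @^-1` C) * P E)%E.
Proof.
move=> mX mY mE XYE C mC.
have mXY : measurable_fun setT (fun w => (X w, Y w)) by exact: measurable_fun_pair.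
have PE0 : 0 <= fine (P E) by exact: fine_ge0.
have PEE : (fine (P E))%:E = P E by rewrite fineK// fin_num_measure.
pose G : set (set (R * R)) := [set A `*` B | A in measurable & B in measurable].
(* The measurability of the pair, an argument of the measure instance of
   [pushforward], is left abstract in [m1] and [m2]. *)
pose m1 : {measure set (R * R) -> \bar R} :=
  pushforward (mrestr P mE) (fun w => (X w, Y w)).
pose m2 : {measure set (R * R) -> \bar R} :=
  mscale (NngNum PE0) (pushforward P (fun w => (X w, Y w))).
have preX A B : (fun w => (X w, Y w)) @^-1` (A `*` B) =
  X @^-1` A `&` Y @^-1` B by [].
rewrite -[LHS]/(m1 mXY C) muleC -PEE -[RHS]/(m2 mXY C).
apply: (measure_unique G (fun=> setT)) => //.
- exact: measurable_prod_measurableType.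
- move=> _ _ [A1 mA1 [B1 mB1 <-]] [A2 mA2 [B2 mB2 <-]].
  exists (A1 `&` A2); first exact: measurableI.
  exists (B1 `&` B2); first exact: measurableI.
  by rewrite setXI.
- by move=> _; exists setT => //; exists setT => //; rewrite setXTT.
- by rewrite bigcup_const//; exists 0%N.
- move=> _ [A mA [B mB <-]].
  by rewrite /m1 /m2/= /mscale/= /pushforward/= /mrestr preX XYE// muleC PEE.
- move=> _; rewrite /m1/= /pushforward/= /mrestr preimage_setT setTI.
  by rewrite (le_lt_trans (probability_le1 _ _)) ?ltry.
Qed.

(** By uniqueness of the product measure, the law of the pair is the product of the two laws;
    Tonelli's theorem gives the iterated integral. *)
Lemma ge0_integral_indep (X Y : {mfun T >-> R}) (f : R * R -> \bar R) :
  (forall A B, measurable A -> measurable B ->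
    P (X @^-1` A `&` Y @^-1` B) = (P (X @^-1` A) * P (Y @^-1` B))%E) ->
  measurable_fun setT f -> (forall z, 0 <= f z)%E ->
  (\int[P]_w f (X w, Y w) =
   \int[distribution P X]_x \int[distribution P Y]_y f (x, y))%E.
Proof.
move=> XY mf f0.
have mXY : measurable_fun setT (fun w => (X w, Y w)).
  exact: measurable_fun_pair.
rewrite -fubini_tonelli1//.
rewrite -(@ge0_integral_pushforward _ _ _ _ _ (fun w => (X w, Y w)) mXY P setT)//.
apply: eq_measure_integral => C mC _.
by apply/esym/product_measure_unique.
Qed.

End independence.

(* [R] as a measurable type and [measurableTypeR R], over which [normal_prob] is
   a measure, carry the same sigma-algebra under two displays; pushing forward to
   the latter lets both sides meet. *)
Lemma ge0_integral_normal_law d (T : measurableType d) (R : realType)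
    (P : probability T R) (X : T -> R) (m s : R) (f : R -> \bar R) :
  measurable_fun setT X ->
  (forall A, measurable A -> P (X @^-1` A) = normal_prob m s A) ->
  measurable_fun setT f -> (forall x, 0 <= f x)%E ->
  (\int[P]_w f (X w) = \int[normal_prob m s]_x f x)%E.
Proof.
move=> mX Xms mf f0.
rewrite -(@ge0_integral_pushforward _ _ _ (measurableTypeR R) R X mX P setT f)//.
by apply: eq_measure_integral => A mA _; exact: Xms.
Qed.

(** * Weighted sums of independent Gaussian variables *)

Section gaussian_sums.
Context d (T : measurableType d) (R : realType) (P : probability T R).
Context (n : nat) (X : 'I_n -> T -> R) (a : 'I_n -> R).
Hypothesis mX : forall i, measurable_fun setT (X i).
Hypothesis indepX : mutually_independent P X.

(** The full range is filtered by [i < k], so that induction on [k] leaves the index type of [X]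
    unchanged. *)
Definition partial_sum (k : nat) (w : T) : R :=
  \sum_(i < n | (i < k)%N) a i * X i w.

Lemma measurable_partial_sum k : measurable_fun setT (partial_sum k).
Proof.
rewrite /partial_sum; under eq_fun do rewrite big_mkcond/=.
by apply: measurable_sum => i /=; case: (i < k)%N => //; exact: measurable_funM.
Qed.

Lemma partial_sumS (k : 'I_n) w :
  partial_sum k.+1 w = partial_sum k w + a k * X k w.
Proof.
rewrite /partial_sum (bigD1 k)//= addrC; congr (_ + _).
by apply: eq_bigl => i; rewrite ltnS ltn_neqAle andbC.
Qed.

Let evt (J : {set 'I_n}) (A : 'I_n -> set R) :=
  \bigcap_(i in [set` J]) X i @^-1` A i.

Let mpre i (A : set R) : measurable A -> measurable (X i @^-1` A).
Proof. by move=> mA; rewrite -[X in measurable X]setTI; exact: mX. Qed.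

Let mevt (J : {set 'I_n}) A : (forall i, i \in J -> measurable (A i)) ->
  measurable (evt J A).
Proof. by move=> mA; apply: fin_bigcap_measurable => // i /mA; exact: mpre. Qed.

Let evt1 k B : X k @^-1` B = evt [set k]%SET (fun=> B).
Proof.
apply/seteqP; split=> w /= h => [i|]; last by apply: h; rewrite /= inE.
by rewrite /= inE => /eqP ->.
Qed.

Let evtU (J : {set 'I_n}) A (k : 'I_n) B : k \notin J ->
  X k @^-1` B `&` evt J A = evt (k |: J) (fun i => if i == k then B else A i).
Proof.
move=> kJ; apply/seteqP; split => w /=.
  move=> [Bw Aw] i /=; rewrite in_setU1; case: eqP => [-> //|_ /= iJ].
  exact: Aw.
move=> H; split.
  by have := H k; rewrite /= setU11 eqxx; apply.
move=> i /= iJ; have := H i; rewrite /= setU1r// => /(_ isT).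
by case: eqP => // ik; move: kJ; rewrite -ik iJ.
Qed.

Let indep_evt (k : 'I_n) (J : {set 'I_n}) A B : k \notin J ->
  (forall i, i \in J -> measurable (A i)) -> measurable B ->
  P (X k @^-1` B `&` evt J A) = (P (X k @^-1` B) * P (evt J A))%E.
Proof.
move=> kJ mA mB; rewrite evtU// /evt !indepX//; last first.
  by move=> i; rewrite in_setU1; case: eqP => //= _ /mA.
rewrite big_setU1//= eqxx; congr (_ * _)%E; apply: eq_bigr => i iJ.
by case: eqP => // ik; move: kJ; rewrite -ik iJ.
Qed.

(** Keeping a whole event on the variables of index at least [k] makes the induction work: at each
    step [X k] leaves the event and joins the sum, and [indep_pair_event] handles the pair formed by
    the sum and [X k]. *)
Let indep_partial_sum_evt k : (k <= n)%N ->
  forall (J : {set 'I_n}) A B, (forall i, i \in J -> (k <= i)%N) ->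
  (forall i, i \in J -> measurable (A i)) -> measurable B ->
  P (partial_sum k @^-1` B `&` evt J A) =
  (P (partial_sum k @^-1` B) * P (evt J A))%E.
Proof.
elim: k => [_ J A B _ mA mB|k IH kn J A B Jk mA mB].
  have -> : partial_sum 0 = cst 0.
    by apply/funext => w; rewrite /partial_sum big_pred0.
  rewrite preimage_cst; case: ifP => _.
    by rewrite setTI probability_setT mul1e.
  by rewrite set0I measure0 mul0e.
pose k' := Ordinal kn.
have kJ : k' \notin J by apply/negP => /Jk; rewrite ltnn.
have mC : measurable [set z : R * R | B (z.1 + a k' * z.2)].
  rewrite -[X in measurable X]setTI.
  suff : measurable_fun setT (fun z : R * R => z.1 + a k' * z.2) by apply.
  by apply: measurable_funD => //; exact: measurable_funM.
have := @indep_pair_event _ _ _ P _ _ _ (measurable_partial_sum k) (mX k') (mevt mA)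
  _ _ mC.
rewrite (_ : _ @^-1` _ = partial_sum k.+1 @^-1` B); last first.
  by apply/seteqP; split => w; rewrite /= -[k]/(nat_of_ord k') partial_sumS.
apply => C D mC' mD.
have Jk' i : i \in J -> (k <= i)%N by move=> /Jk/ltnW.
(* The induction hypothesis serves twice: here with [k'] added to [J], and below with the singleton
   of [k']. *)
rewrite -setIA evtU// IH//; [|exact: ltnW| |]; last 2 first.
- by move=> i; rewrite in_setU1 => /orP[/eqP->//|/Jk'].
- by move=> i; rewrite in_setU1; case: eqP => //= _ /mA.
rewrite -evtU// indep_evt// muleA; congr (_ * _)%E.
rewrite evt1 IH// => [|i]; first exact: ltnW.
by rewrite inE => /eqP ->.
Qed.

Lemma indep_partial_sum (k : 'I_n) A B : measurable A -> measurable B ->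
  P (partial_sum k @^-1` A `&` X k @^-1` B) =
  (P (partial_sum k @^-1` A) * P (X k @^-1` B))%E.
Proof.
move=> mA mB; rewrite evt1 indep_partial_sum_evt//; first exact: ltnW.
by move=> i; rewrite inE => /eqP ->.
Qed.

(** Integrating out the last summand turns the width [s] into a larger or equal one, its variance
    increased by that of the summand. The width is therefore quantified after [k]: the induction
    hypothesis is applied at [s']. *)
Lemma integral_normal_pdf_partial_sum (t : R) : 0 < t ->
  (forall i A, measurable A -> P (X i @^-1` A) = normal_prob 0 t A) ->
  forall k, (k <= n)%N -> forall s, 0 < s ->
  (\int[P]_w (normal_pdf 0 s (partial_sum k w))%:E =
   (normal_pdf 0
     (Num.sqrt (s ^+ 2 + (\sum_(i < n | (i < k)%N) a i ^+ 2) * t ^+ 2)) 0)%:E)%E.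
Proof.
move=> t0 Xt; elim => [_ s s0|k IH kn s s0].
  rewrite [in RHS]big_pred0// mul0r addr0 sqrtr_sqr gtr0_norm//.
  under eq_integral do rewrite /partial_sum big_pred0//.
  by rewrite integral_cst//= probability_setT mule1.
pose k' := Ordinal kn.
pose Y : {mfun T >-> R} := mfun_Sub (mem_set (measurable_partial_sum k)).
pose Z : {mfun T >-> R} := mfun_Sub (mem_set (mX k')).
pose f (z : R * R) := (normal_pdf 0 s (z.1 + a k' * z.2))%:E.
have mf : measurable_fun setT f.
  apply/measurable_EFinP; apply: measurableT_comp.
    exact: measurable_normal_pdf.
  by apply: measurable_funD => //; exact: measurable_funM.
have f0 z : (0 <= f z)%E by rewrite lee_fin normal_pdf_ge0.
transitivity (\int[P]_w f (Y w, Z w))%E.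
  by apply: eq_integral => w _; rewrite -[k]/(nat_of_ord k') partial_sumS.
rewrite ge0_integral_indep//; last first.
  by move=> A B mA mB; exact: (@indep_partial_sum k').
pose s' := Num.sqrt (s ^+ 2 + a k' ^+ 2 * t ^+ 2).
have s'0 : 0 < s' by rewrite sqrtr_gt0 ltr_pwDl ?exprn_gt0// mulr_ge0 ?sqr_ge0.
transitivity (\int[distribution P Y]_x (normal_pdf 0 s' x)%:E)%E.
  apply: eq_integral => x _; rewrite -(integral_normal_pdf_shift _ _ s0 t0).
  have mfx : measurable_fun setT (fun y => f (x, y)) by exact: measurable_fun_pair2.
  rewrite ge0_integral_distribution//.
  apply: (@ge0_integral_normal_law _ _ _ _ _ _ _ (fun y => f (x, y))) => // A.
  exact: Xt.
rewrite ge0_integral_distribution//=; last 2 first.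
- by apply/measurable_EFinP; exact: measurable_normal_pdf.
- by move=> y; rewrite lee_fin normal_pdf_ge0.
rewrite IH ?(ltnW kn)//.
congr (normal_pdf _ (Num.sqrt _) _)%:E; rewrite sqr_sqrtr; last first.
  by rewrite addr_ge0 ?sqr_ge0// mulr_ge0 ?sqr_ge0.
rewrite -addrA -mulrDl; congr (_ + _ * _).
rewrite [RHS](bigD1 k')//=; congr (_ + _).
by apply: eq_bigl => i; rewrite [LHS]ltn_neqAle andbC.
Qed.

End gaussian_sums.

(** * Small-ball estimate *)

Lemma normal_peakE (R : realType) (s : R) : 0 < s ->
  normal_peak s = (s * Num.sqrt (pi *+ 2))^-1.
Proof.
by move=> s0; rewrite /normal_peak -mulrnAr sqrtrM ?sqr_ge0// sqrtr_sqr gtr0_norm.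
Qed.

(** On the event, the density of width [s] at [S] is at least its peak divided by [expR 1], while
    its mean is at most the peak of width [v]. The quotient of these bounds is the claimed one. *)
Lemma normal_small_ball d (T : measurableType d) (R : realType)
    (P : probability T R) (S : T -> R) (v s : R) :
  measurable_fun setT S -> 0 < v -> 0 < s ->
  (\int[P]_w (normal_pdf 0 s (S w))%:E =
   (normal_pdf 0 (Num.sqrt (s ^+ 2 + v ^+ 2)) 0)%:E)%E ->
  (P [set w | `|S w| <= s]%R <= (expR 1 * s / v)%:E)%E.
Proof.
move=> mS v0 s0 Sv; set B := [set w | _].
have mB : measurable B.
  rewrite -[B]setTI; apply: measurable_fun_le => //.
  exact: measurableT_comp.
set r := Num.sqrt _ in Sv.
have vr : v <= r.
  rewrite -[v]gtr0_norm// -sqrtr_sqr ler_wsqrtr// lerDr.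
  exact: sqr_ge0.
have r0 : 0 < r by exact: lt_le_trans vr.
have p0 : 0 < Num.sqrt (pi *+ 2 : R) by rewrite sqrtr_gt0 pmulrn_lgt0 ?pi_gt0.
(* This is [normal_peak s] divided by [expR 1]. *)
pose c : R := (expR 1 * (s * Num.sqrt (pi *+ 2)))^-1.
have c0 : 0 < c by rewrite invr_gt0 mulr_gt0 ?expR_gt0// mulr_gt0.
have /(@le_trans _ _ _ (c%:E * P B)%E) :
    (\int[P]_w (c%:E * (\1_B w)%:E) <= (normal_pdf 0 r 0)%:E)%E.
  rewrite -Sv; apply: ge0_le_integral => //.
  - by move=> w _; rewrite mule_ge0// lee_fin ltW.
  - apply: emeasurable_funM => //; apply/measurable_EFinP.
    exact: measurable_indic.
  - apply/measurable_EFinP; apply: measurableT_comp => //.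
    exact: measurable_normal_pdf.
  move=> w _; rewrite -EFinM lee_fin indicE.
  have [/set_mem Bw|_] := boolP (w \in B); last by rewrite mulr0 normal_pdf_ge0.
  rewrite mulr1 normal_pdfE ?gt_eqF// /c normal_peakE// invfM mulrC.
  rewrite ler_pM2l ?invr_gt0 ?mulr_gt0// -expRN ler_expR subr0 mulNr lerN2.
  rewrite ler_pdivrMr ?pmulrn_lgt0 ?exprn_gt0// mul1r.
  rewrite -[S w ^+ 2]real_normK ?num_real// (le_trans (y := s ^+ 2))//.
    by rewrite ler_pXn2r// nnegrE// ltW.
  by rewrite mulr2n lerDl sqr_ge0.
rewrite ge0_integralZl//; last first.
- by rewrite lee_fin ltW.
- by apply/measurable_EFinP; exact: measurable_indic.
rewrite integral_indic// setIT => /(_ (lexx _)) cP.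
rewrite -(@lee_pmul2l _ c%:E)// ?lte_fin//.
apply: le_trans cP _; rewrite -EFinM lee_fin.
apply: le_trans (normal_pdf_ub _ _ _) _; first by rewrite gt_eqF.
rewrite normal_peakE// /c.
have -> : (expR 1 * (s * Num.sqrt (pi *+ 2)))^-1 * (expR 1 * s / v) =
    (v * Num.sqrt (pi *+ 2))^-1 :> R.
  move: (expR_gt0 (1 : R)) p0; move: (expR 1) (Num.sqrt _) => e p e0 p0.
  by field; rewrite !gt_eqF.
by rewrite lef_pV2 ?posrE ?mulr_gt0// ler_pM2r.
Qed.

(** * Riemann sums of a continuous function against a bounded one *)

Section riemann_sums.
Context (R : realType).
Implicit Types (f h : R -> R) (n i : nat).
Local Notation mu := (@lebesgue_measure R).

Definition cell n i : set R := `[i%:R / n%:R, i.+1%:R / n%:R[.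

Lemma cell01 n i : (i < n)%N -> cell n i `<=` `[0, 1[.
Proof.
move=> ni x; rewrite /cell/= !in_itv/= => /andP[ix xi].
have n0 : 0 < n%:R :> R by rewrite ltr0n; apply: leq_ltn_trans ni.
rewrite (le_trans _ ix) ?divr_ge0//= (lt_le_trans xi)//.
by rewrite ler_pdivrMr// mul1r ler_nat.
Qed.

Lemma mu_cell n i : (0 < n)%N -> mu (cell n i) = (n%:R^-1)%:E.
Proof.
move=> n0; have n0' : 0 < n%:R^-1 :> R by rewrite invr_gt0 ltr0n.
rewrite /cell lebesgue_measure_itv/= lte_fin ltr_pM2r// ltr_nat ltnSn.
by rewrite -EFinB -mulrBl -natrB// subSnn mul1r.
Qed.

Lemma Rintegral_cells n f : (0 < n)%N -> mu.-integrable `[0, 1] (EFin \o f) ->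
  \int[mu]_(x in `[0, 1]) f x = \sum_(i < n) \int[mu]_(x in cell n i) f x.
Proof.
move=> n0 intf.
have intf1 : mu.-integrable `[0, 1[ (EFin \o f).
  by apply: integrableS intf => //; exact: subset_itv_co_cc.
rewrite -Rintegral_itv_bndo_bndc//.
have nR0 : 0 < n%:R :> R by rewrite ltr0n.
suff H k : (k <= n)%N -> \int[mu]_(x in `[0, (k%:R / n%:R)%R[) f x =
    \sum_(i < k) \int[mu]_(x in cell n i) f x.
  by rewrite -H// divff// gt_eqF.
elim: k => [_|k IH kn].
  by rewrite mul0r set_itvxx Rintegral_set0 big_ord0.
have k0 : 0 <= k%:R / n%:R :> R by rewrite divr_ge0 ?ler0n.
have kS : k%:R / n%:R <= k.+1%:R / n%:R :> R by rewrite ler_pM2r ?invr_gt0// ler_nat.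
rewrite big_ord_recr/= -IH ?(ltnW kn)//.
rewrite (@itv_bndbnd_setU _ _ _ (BLeft (k%:R / n%:R)))// Rintegral_setU//.
  rewrite -itv_bndbnd_setU//; apply: integrableS intf1 => //.
  apply: subset_itvl; rewrite bnd_simp.
  by rewrite ler_pdivrMr// mul1r ler_nat.
apply/disj_setPS => y [/=]; rewrite 2!in_itv/= => /andP[_ yx] /andP[].
by rewrite leNgt yx.
Qed.

(** Compactness is used in its near-covering form: the estimate holds near each point for all large
    [n], hence on the whole segment for all large [n]. *)
Lemma unif_continuous01 f (e : R) : 0 < e -> {within `[0, 1], continuous f} ->
  \forall n \near \oo, forall x y, 0 <= x <= 1 -> 0 <= y <= 1 ->
    `|x - y| <= n%:R^-1 -> `|f x - f y| <= e.
Proof.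
move=> e0 /subspace_continuousP cf.
have /compact_near_coveringP/near_covering_withinP cov := @segment_compact R 0 1.
have H (x : R) : `[0, 1]%classic x ->
    \forall x' \near x & n \near \oo, `[0, 1]%classic x' ->
    forall y, 0 <= y <= 1 -> `|x' - y| <= n%:R^-1 -> `|f x' - f y| <= e.
  move=> /[dup] x01 /cf /cvgrPdist_le/(_ (e / 2)); rewrite divr_gt0// => /(_ isT).
  rewrite near_withinE => /nbhs_ballP[d/= d0 xd].
  (* Half of [d] is spent on the distance from [x] to [x'] and half on the mesh, so that [y] is also
     within [d] of [x]. *)
  exists (ball x (d / 2), [set n : nat | n%:R^-1 < d / 2]).
    split=> /=; first by apply: nbhsx_ballx; rewrite divr_gt0.
    exists (Num.truncn (d / 2)^-1).+1 => //= n dn.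
    rewrite /= invf_plt ?posrE ?divr_gt0// ?ltr0n ?(leq_trans _ dn)//.
    by rewrite (lt_le_trans (truncnS_gt _))// ler_nat.
  move=> [x' n] /= [xx' nd] x'01 y y01 x'y.
  have Hx' : `|f x - f x'| <= e / 2.
    apply: xd => //; apply: le_ball xx'; lra.
  have Hy : `|f x - f y| <= e / 2.
    apply: xd; last by rewrite /= in_itv.
    move: xx'; rewrite /ball/= => xx'.
    rewrite -(subrKA x') (le_lt_trans (ler_normD _ _))//.
    by rewrite [ltRHS](splitr d) ltr_leD// ltW// (le_lt_trans x'y).
  rewrite -(subrKA (f x)) (le_trans (ler_normD _ _))//.
  by rewrite [leRHS](splitr e) lerD// distrC.
apply: filterS (cov nat _ _ _ H) => n Hn x y x01; apply: Hn.
by rewrite /= in_itv.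
Qed.

(** Only [f] is sampled; [h], merely bounded and measurable, is integrated exactly on each cell.
    Each of the [n] cells thus contributes an error of at most [e * C / n%:R]. *)
Lemma riemann_dist f h (C e : R) n : (0 < n)%N ->
  {within `[0, 1], continuous f} ->
  measurable_fun setT h -> (forall x, `|h x| <= C) ->
  (forall x y, 0 <= x <= 1 -> 0 <= y <= 1 ->
    `|x - y| <= n%:R^-1 -> `|f x - f y| <= e) ->
  `|inner01 f h - \sum_(i < n) f (i%:R / n%:R) * \int[mu]_(x in cell n i) h x|
    <= e * C.
Proof.
move=> n0 cf mh hC fe.
have nR0 : 0 < n%:R :> R by rewrite ltr0n.
have e0 : 0 <= e.
  by apply: le_trans (fe 0 0 _ _ _); rewrite ?lexx ?ler01// subrr normr0 invr_ge0.
have bh A : [bounded h x | x in A].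
  exists C; split; first exact: num_real.
  by move=> y Cy x _ /=; rewrite (le_trans (hC x))// ltW.
have ifh : mu.-integrable `[0, 1] (EFin \o (fun x => f x * h x)).
  have intf : mu.-integrable `[0, 1] (EFin \o f).
    by apply: continuous_compact_integrable => //; exact: segment_compact.
  by apply: (integrableMl _ intf (measurable_funTS mh) (bh _)).
have finc i : (mu (cell n i) < +oo)%E by rewrite mu_cell// ltry.
have mcell i : measurable (cell n i : set (measurableTypeR R)).
  exact: measurable_itv.
have ih i : mu.-integrable (cell n i) (EFin \o h).
  apply: measurable_bounded_integrable;
    [exact: mcell|exact: finc|exact: measurable_funTS mh|exact: bh].
rewrite /inner01 (Rintegral_cells n0)// -sumrB (le_trans (ler_norm_sum _ _ _))//.
have -> : e * C = \sum_(i < n) e * C / n%:R.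
  by rewrite sumr_const card_ord -[RHS]mulr_natr divfK// gt_eqF.
apply: ler_sum => i _.
have ifhi : mu.-integrable (cell n i) (EFin \o (fun x => f x * h x)).
  apply: (integrableS _ (mcell i) _ ifh); first exact: measurable_itv.
  by apply: subset_trans (cell01 _) _ => //; exact: subset_itv_co_cc.
have ifih : mu.-integrable (cell n i) (EFin \o (fun x => f (i%:R / n%:R) * h x)).
  exact: (integrableZl (mcell i) _ (ih i)).
rewrite -(RintegralZl _ (mcell i) (ih i)) -(RintegralB (mcell i) ifhi ifih).
have iB := integrableB (mcell i) ifhi ifih.
rewrite (le_trans (le_normr_Rintegral (mcell i) iB))//.
have -> : e * C / n%:R = \int[mu]_(x in cell n i) (e * C).
  by rewrite (Rintegral_cst _ (mcell i)) /= mu_cell.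
apply: le_Rintegral => //.
- exact: (integrable_norm iB).
- by apply: measurable_bounded_integrable;
    [exact: mcell|exact: finc| |exact: bounded_cst].
move=> x xi; rewrite -mulrBl normrM ler_pM//.
have := cell01 (ltn_ord i) xi; rewrite /= in_itv/= => /andP[x0 x1].
move: xi; rewrite /cell/= in_itv/= => /andP[ix xi].
apply: fe; first by rewrite x0 ltW.
  by rewrite divr_ge0//= (le_trans ix)// ltW.
rewrite ger0_norm ?subr_ge0// lerBlDr (le_trans (ltW xi))//.
by rewrite -[X in X + _]mul1r -mulrDl nat1r.
Qed.

End riemann_sums.

(** * Summation by parts and tail sums *)

(** As [f 0] vanishes, [f i] is the sum of the increments of index below [i]; increment [j] thus
    collects the weights of index at least [j.+1]. *)
Lemma abel_sum (R : comPzRingType) (f b : nat -> R) n : f 0%N = 0 ->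
  \sum_(i < n) f i * b i =
  \sum_(j < n) (\sum_(j.+1 <= i < n) b i) * (f j.+1 - f j).
Proof.
move=> f0; elim: n => [|n IH]; first by rewrite !big_ord0.
rewrite !big_ord_recr/= big_geq// mul0r addr0.
under [RHS]eq_bigr => j _ do rewrite big_nat_recr//= mulrDl.
rewrite big_split/= -IH -mulr_sumr; congr (_ + _).
rewrite -(big_mkord predT (fun i => f i.+1 - f i)) telescope_sumr//.
by rewrite f0 subr0 mulrC.
Qed.

(** Two tails at distance [r] inside the constant block differ by [r%:R * c], and the squares of two
    numbers sum to at least half the square of their difference. The block contains [r] disjoint
    such pairs; the other tails are dropped. *)
Lemma sum_tails_sqr_ge (R : realFieldType) (b : nat -> R) (n x r : nat) (c : R) :
  (x + r + r <= n)%N -> (forall i, (x <= i < x + r + r)%N -> b i = c) ->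
  r%:R * (r%:R * c) ^+ 2 / 2 <= \sum_(j < n) (\sum_(j.+1 <= i < n) b i) ^+ 2.
Proof.
move=> xn bc; pose a j := \sum_(j.+1 <= i < n) b i.
have ad i : (i < r)%N -> a (x + i)%N - a (x + r + i)%N = r%:R * c.
  move=> ir; rewrite /a (big_cat_nat (n := (x + r + i).+1))/=; last 2 first.
  - by rewrite ltnS addnAC leq_addr.
  - by apply: leq_trans xn; rewrite -addnS leq_add2l.
  rewrite addrK big_nat_cond (eq_bigr (fun=> c)); last first.
    move=> j /andP[/andP[xj jx] _]; apply: bc.
    rewrite (leq_trans _ (ltnW xj)) ?leq_addr//=.
    by apply: leq_trans jx _; rewrite -addnS leq_add2l.
  rewrite -big_nat_cond sumr_const_nat mulr_natl; congr (_ *+ _).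
  by rewrite subSS addnAC addnC addnK.
have -> : r%:R * (r%:R * c) ^+ 2 / 2 = \sum_(i < r) (r%:R * c) ^+ 2 / 2.
  by rewrite sumr_const card_ord -[RHS]mulr_natl mulrA.
rewrite -(big_mkord predT (fun j => a j ^+ 2)).
have xrn : (x + r <= n)%N by apply: leq_trans xn; rewrite leq_addr.
rewrite (big_cat_nat (n := x))//=; last by apply: leq_trans xrn; rewrite leq_addr.
rewrite (big_cat_nat (n := (x + r)%N) (m := x))//=; last by rewrite leq_addr.
rewrite (big_cat_nat (n := (x + r + r)%N) (m := (x + r)%N))//=; last first.
  by rewrite leq_addr.
have shift y F : \sum_(y <= j < y + r) F j = \sum_(i < r) F (y + i)%N :> R.
  rewrite -{1}[y]add0n big_addn addKn big_mkord.
  by apply: eq_bigr => i _; rewrite addnC.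
rewrite !shift.
have sq_ge0 u v : 0 <= \sum_(u <= j < v) a j ^+ 2.
  by apply: sumr_ge0 => j _; rewrite sqr_ge0.
apply: (@le_trans _ _ (\sum_(i < r) a (x + i)%N ^+ 2 +
                       \sum_(i < r) a (x + r + i)%N ^+ 2)).
  rewrite -big_split/=; apply: ler_sum => i _; rewrite -(ad i)//.
  have := sqr_ge0 (a (x + i)%N + a (x + r + i)%N); nra.
by rewrite ler_wpDl// lerD2l lerDl.
Qed.

(** * Inner products of a Brownian path with a bounded function *)

Section brownian_coefficients.
Context (R : realType) d (T : measurableType d) (P : probability T R).
Variables (sigma : R) (s : R -> {RV P >-> R}).
Hypothesis sigma0 : 0 < sigma ^+ 2.
Hypothesis bm : brownian_motion01 sigma s.
Variables (h : R -> R) (C c : R) (N p : nat).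
Hypothesis mh : measurable_fun setT h.
Hypothesis hC : forall x, `|h x| <= C.
Hypothesis c0 : c != 0.
Hypothesis pN : (p < N)%N.
Hypothesis hc : forall x, p%:R / N%:R <= x < p.+1%:R / N%:R -> h x = c.
Local Notation mu := (@lebesgue_measure R).

Let N0 : (0 < N)%N. Proof. exact: leq_ltn_trans pN. Qed.

(* With 2(r+1) cells in each interval [p/N, (p+1)/N), the tails at distance r+1
   inside the one where h = c differ by c / (2N). *)
Let size_ r := (N * (r.+1 + r.+1))%N.

Let size_gt0 r : (0 < size_ r)%N. Proof. by rewrite muln_gt0 N0. Qed.

Let sizeR_gt0 r : 0 < (size_ r)%:R :> R. Proof. by rewrite ltr0n. Qed.

Let b r i : R := \int[mu]_(x in cell (size_ r) i) h x.

Let tail r j : R := \sum_(j.+1 <= i < size_ r) b r i.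

Let incr r (j : 'I_(size_ r)) w : R :=
  s (j.+1%:R / (size_ r)%:R) w - s (j%:R / (size_ r)%:R) w.

(** The Riemann sum in its form after summation by parts, a weighted sum of independent
    increments. *)
Let riemann r w : R := \sum_(j < size_ r) tail r j * incr j w.

(** These indices are those of the cells that subdivide the interval where [h] equals [c]. *)
Let bE r i : (p * (r.+1 + r.+1) <= i < p * (r.+1 + r.+1) + r.+1 + r.+1)%N ->
  b r i = c / (size_ r)%:R.
Proof.
move=> /andP[pi ip].
have r0 : 0 < (r.+1 + r.+1)%:R :> R by rewrite ltr0n.
have NR0 : 0 < N%:R :> R by rewrite ltr0n.
have sizeE (x : R) : x / (size_ r)%:R = x / (r.+1 + r.+1)%:R / N%:R.
  by rewrite /size_ natrM invfM mulrA mulrAC.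
rewrite /b (@eq_Rintegral _ _ _ _ _ (cst c)); last first.
  move=> x /set_mem; rewrite /cell/= in_itv/= !sizeE => /andP[ix xi].
  apply: hc; rewrite (le_trans _ ix)/= ?(lt_le_trans xi)//.
    by rewrite ler_pM2r ?invr_gt0// ler_pdivrMr// -natrM ler_nat mulSnr addnA.
  by rewrite ler_pM2r ?invr_gt0// ler_pdivlMr// -natrM ler_nat.
rewrite Rintegral_cst; last exact: measurable_itv.
by rewrite /= mu_cell.
Qed.

(** The right-hand side is the variance of [riemann r]. There are [r.+1] pairs of tails with gap
    [c / (2 * N%:R)], and the factor [r.+1] cancels against the one in [size_ r], which leaves a
    bound free of [r]. *)
Let var_tail r : sigma ^+ 2 * c ^+ 2 / (16 * N%:R ^+ 3) <=
  (\sum_(j < size_ r) tail r j ^+ 2) * (sigma ^+ 2 / (size_ r)%:R).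
Proof.
have := @sum_tails_sqr_ge R (b r) (size_ r) (p * (r.+1 + r.+1)) r.+1
  (c / (size_ r)%:R).
have : (p * (r.+1 + r.+1) + r.+1 + r.+1 <= size_ r)%N.
  by rewrite -addnA -mulSnr leq_pmul2r.
move=> /[swap] /[apply] /(_ (@bE r)); rewrite -/(tail _) => H.
have n0 := sizeR_gt0 r.
rewrite [leRHS]mulrC [leRHS]mulrAC ler_pdivlMr//.
apply: le_trans (ler_wpM2l (ltW sigma0) H).
have r0 : 0 < r.+1%:R :> R by rewrite ltr0n.
have NR0 : 0 < N%:R :> R by rewrite ltr0n.
rewrite le_eqVlt; apply/orP; left; apply/eqP.
rewrite /size_ natrM natrD; field.
by rewrite !gt_eqF// addr_gt0.
Qed.

Let mincr r (j : 'I_(size_ r)) : measurable_fun setT (incr j).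
Proof. exact: measurable_funB. Qed.

Let mriemann r : measurable_fun setT (riemann r).
Proof. by apply: measurable_sum => j; exact: measurable_funM. Qed.

Let riemann_small_ball r (e : R) : 0 < e ->
  (P [set w | `|riemann r w| <= e]%R <=
   (expR 1 * e / Num.sqrt (sigma ^+ 2 * c ^+ 2 / (16 * N%:R ^+ 3)))%:E)%E.
Proof.
move=> e0; have n0 := sizeR_gt0 r.
set v0 := _ / (16 * _).
have v00 : 0 < v0.
  have c2 : 0 < c ^+ 2 by rewrite exprn_even_gt0.
  have N3 : 0 < N%:R ^+ 3 :> R by rewrite exprn_gt0 ?ltr0n.
  by apply: divr_gt0; apply: mulr_gt0.
(* The standard deviation of [riemann r], to be replaced by its lower bound from [var_tail]. *)
pose v := Num.sqrt
  ((\sum_(j < size_ r) tail r j ^+ 2) * (sigma ^+ 2 / (size_ r)%:R)).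
have v0v : Num.sqrt v0 <= v by rewrite ler_wsqrtr// var_tail.
have sv0 : 0 < Num.sqrt v0 by rewrite sqrtr_gt0.
have v_gt0 : 0 < v by exact: lt_le_trans v0v.
apply: (@le_trans _ _ (expR 1 * e / v)%:E); last first.
  by rewrite lee_fin ler_pM2l ?mulr_gt0 ?expR_gt0// lef_pV2 ?posrE.
apply: normal_small_ball => //.
pose t : R := Num.sqrt (sigma ^+ 2 / (size_ r)%:R).
have t0 : 0 < t by rewrite sqrtr_gt0 divr_gt0.
have ind : mutually_independent P (@incr r).
  apply: (bm_indep bm (t := fun i => i%:R / (size_ r)%:R)).
  - by rewrite mul0r.
  - by move=> i _; rewrite ltr_pM2r ?invr_gt0// ltr_nat.
  - by rewrite divff// gt_eqF.
have law j A : measurable A -> P (@incr r j @^-1` A) = normal_prob 0 t A.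
  move=> mA; have u0 : 0 <= j%:R / (size_ r)%:R :> R by rewrite divr_ge0 ?ler0n.
  have ut : j%:R / (size_ r)%:R < j.+1%:R / (size_ r)%:R :> R.
    by rewrite ltr_pM2r ?invr_gt0// ltr_nat.
  have t1 : j.+1%:R / (size_ r)%:R <= 1 :> R.
    by rewrite ler_pdivrMr// mul1r ler_nat.
  have tE : j.+1%:R / (size_ r)%:R - j%:R / (size_ r)%:R = (size_ r)%:R^-1 :> R.
    by rewrite -mulrBl -natrB// subSnn mul1r.
  have := bm_gauss bm u0 ut t1 mA; rewrite tE.
  exact: etrans.
have := integral_normal_pdf_partial_sum
  (fun j : 'I_(size_ r) => tail r j) (@mincr r) ind t0 law (leqnn _) e0.
rewrite /t (sqr_sqrtr (ltW _)) ?divr_gt0// /v sqr_sqrtr; last first.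
  by rewrite mulr_ge0 ?sumr_ge0// => [? _|]; rewrite ?sqr_ge0// ltW// divr_gt0.
under [in LHS]eq_integral => w _ do rewrite /partial_sum.
have E F : \sum_(i < size_ r | (i < size_ r)%N) F i = \sum_(i < size_ r) F i :> R.
  by apply: eq_bigl => i; rewrite ltn_ord.
rewrite !E => <-; apply: eq_integral => w _.
by rewrite E.
Qed.

Let riemann_cvg w : s 0 w = 0 -> {within `[0, 1], continuous (fun t => s t w)} ->
  forall e, 0 < e -> \forall r \near \oo,
    `|inner01 (fun t => s t w) h - riemann r w| <= e.
Proof.
move=> sw0 cs e e0.
(* C may be 0. *)
have C1 : 0 < C + 1.
  by rewrite ltr_wpDl// (le_trans _ (hC 0)).
have eC : 0 < e / (C + 1) by rewrite divr_gt0.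
have [M _ HM] := unif_continuous01 eC cs.
exists M => // r /= Mr.
have -> : riemann r w =
    \sum_(i < size_ r) s (i%:R / (size_ r)%:R) w * b r i.
  by rewrite (@abel_sum _ (fun i => s (i%:R / (size_ r)%:R) w))// mul0r.
apply: le_trans (riemann_dist (e := e / (C + 1)) _ cs mh hC _) _ => //.
  (* The number of cells [size_ r] is at least [r], so the mesh is fine enough from [r = M] on. *)
  apply: HM => /=; rewrite (leq_trans Mr)// /size_ (leq_trans _ (leq_pmull _ N0))//.
  by rewrite addSn ltnW// ltnS leq_addr.
rewrite mulrAC ler_pdivrMr// ler_pM2l//.
by rewrite lerDl.
Qed.

(** If the inner product vanishes, then for each [k] the Riemann sums are eventually bounded by the
    inverse of [k.+1]. This has probability at most [K] times that inverse, so the event for all [k]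
    at once is null. *)
Lemma brownian_inner_neq0 : {ae P, forall w, inner01 (fun t => s t w) h != 0}.
Proof.
pose K : R := expR 1 / Num.sqrt (sigma ^+ 2 * c ^+ 2 / (16 * N%:R ^+ 3)).
pose B k r := [set w | `|riemann r w| <= k.+1%:R^-1 :> R].
(* The union of [F k m] over [m] says that the bound holds eventually; [F k m] increases with [m],
   so its measure converges to that of the union. *)
pose F k m := \bigcap_(r in [set r | (m <= r)%N]) B k r.
have mB k r : measurable (B k r).
  rewrite -[B k r]setTI; apply: measurable_fun_le => //.
  exact: measurableT_comp.
have mF k m : measurable (F k m) by apply: bigcap_measurableType => *.
have mUF k : measurable (\bigcup_m F k m) by apply: bigcup_measurable => m _.
have mZ : measurable (\bigcap_k \bigcup_m F k m).
  by apply: bigcap_measurableType => *.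
have k0 k : 0 < k.+1%:R^-1 :> R by rewrite invr_gt0.
have PF k m : (P (F k m) <= (K * k.+1%:R^-1)%:E)%E.
  apply: le_trans (_ : _ <= P (B k m))%E _.
    by apply: le_measure; rewrite ?inE// => w; apply => /=.
  by rewrite /K mulrAC; exact: riemann_small_ball.
have PUF k : (P (\bigcup_m F k m) <= (K * k.+1%:R^-1)%:E)%E.
  have /cvg_lim <- // : P \o F k @ \oo --> P (\bigcup_m F k m).
    apply: nondecreasing_cvg_mu => //.
    move=> m n mn; apply/subsetPset => w Fw r /= nr; apply: Fw => /=.
    exact: leq_trans nr.
  apply: lime_le; last by apply: nearW => m; exact: PF.
  apply: ereal_nondecreasing_is_cvgn => m n mn.
  apply: le_measure; rewrite ?inE// => w Fw r /= nr; apply: Fw => /=.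
  exact: leq_trans nr.
have Z : P (\bigcap_k \bigcup_m F k m) = 0%E.
  apply/eqP; rewrite eq_le measure_ge0 andbT.
  apply/lee_addgt0Pr => e e0; rewrite add0e.
  have K0 : 0 <= K by rewrite divr_ge0 ?expR_ge0// sqrtr_ge0.
  (* With this [k], [k.+1] exceeds [K / e], which makes the bound on the probability at most [e]. *)
  pose k := Num.truncn (K / e).
  apply: le_trans (_ : _ <= P (\bigcup_m F k m))%E _.
    by apply: le_measure; rewrite ?inE// => w; apply.
  apply: le_trans (PUF k) _; rewrite lee_fin ler_pdivrMr// mulrC -ler_pdivrMr//.
  by rewrite ltW// truncnS_gt.
have aeZ : {ae P, forall w, ~ (\bigcap_k \bigcup_m F k m) w}.
  exists (\bigcap_k \bigcup_m F k m); split => // w /= /contrapT; exact.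
apply: filterS3 aeZ (bm_start bm) (bm_cont bm) => w nZw sw0 cs.
apply/eqP => I0; apply: nZw => k _.
have [m _ Hm] := riemann_cvg sw0 cs (k0 k).
exists m => // r /= /Hm /=.
by rewrite I0 sub0r normrN.
Qed.

End brownian_coefficients.

(** * Measurability, boundedness and local constancy of the Haar functions *)

Lemma measurable_haar (R : realType) n : measurable_fun setT (@haar R n).
Proof.
case: n => [|n]; first exact: measurable_indic.
apply: measurable_funM => //.
apply: (measurableT_comp (f := @haar_psi R)).
  by apply: measurable_funB; exact: measurable_indic.
by apply: measurable_funB => //; exact: measurable_funM.
Qed.

Lemma haar_bounded (R : realType) n : exists C, forall x : R, `|haar n x| <= C.
Proof.
have i1 (A : set R) x : `|\1_A x| <= 1 :> R.
  by rewrite indicE; case: (_ \in _); rewrite /= ?normr1 ?normr0.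
case: n => [|n]; first by exists 1 => x; exact: i1.
exists (`|2 `^ ((trunc_log 2 n.+1)%:R / 2)| * (1 + 1)) => x.
rewrite /haar /haar_psijk normrM ler_wpM2l//.
by apply: le_trans (ler_normB _ _) (lerD (i1 _ _) (i1 _ _)).
Qed.

Lemma haar_locally_cst (R : realType) n : exists (N p : nat) (c : R),
  [/\ (p < N)%N, c != 0 &
    forall x, p%:R / N%:R <= x < p.+1%:R / N%:R -> haar n x = c].
Proof.
case: n => [|n].
  exists 1%N, 0%N, 1; split => //.
  move=> x; rewrite mul0r divr1 => /andP[x0 x1].
  by rewrite /haar /haar_phi indicE mem_set//= in_itv/= x0 ltW.
rewrite /haar; set j := trunc_log 2 _; set k := (_ - _)%N.
(* The left half of the support of the wavelet, taken without its right end: at the midpoint both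
   indicators of [haar_psi] are 1 and cancel. *)
exists (2 ^ j * 2)%N, (k * 2)%N, (2 `^ (j%:R / 2)); split.
- rewrite ltn_pmul2r// /k -(ltn_add2r (2 ^ j)) subnK ?trunc_logP//.
  by rewrite addnn -mul2n -expnS trunc_log_ltn.
- by rewrite gt_eqF// powR_gt0.
have j0 : 0 < 2 ^+ j :> R by rewrite exprn_gt0.
move=> x; rewrite -natr1 !natrM natrX => /andP[].
rewrite ler_pdivrMr ?mulr_gt0// ltr_pdivlMr ?mulr_gt0// => xl xu.
rewrite /haar_psijk /haar_psi !indicE mem_set ?memNset ?subr0 ?mulr1//= in_itv/=.
  by apply/negP; rewrite negb_and -ltNge; apply/orP; left; lra.
by apply/andP; split; lra.
Qed.

(** * Equality of the mean square errors *)

Theorem corollary1 (R : realType) (d : measure_display) (T : measurableType d)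
    (P : probability T R) (sigma : R) (s : R -> {RV P >-> R}) :
  0 < sigma ^+ 2 ->
  brownian_motion01 sigma s ->
  forall M : nat, MSE (P_greedy M) s = MSE (P_lin M) s.
Proof.
move=> sigma0 bm M; apply: ge0_integral_ae_eq.
- by move=> w; apply: integral_ge0 => x _; rewrite lee_fin sqr_ge0.
- by move=> w; apply: integral_ge0 => x _; rewrite lee_fin sqr_ge0.
(* Each index has its own null set; as there are countably many, one null set serves all [n]. *)
have : {ae P, forall w, forall n, haar_coef (fun t => s t w) n != 0}.
  apply: ae_foralln => n.
  have [C hC] := haar_bounded R n.
  have [N [p [c [pN c0 hc]]]] := haar_locally_cst R n.
  exact: (brownian_inner_neq0 sigma0 bm (@measurable_haar R n) hC c0 pN hc).
by apply: filterS => w cw; rewrite P_greedy_coef_neq0.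
Qed.
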